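(* Let $m,s\ge2$ be integers. Then, for any prime power $q$, there exists a $[\mathcal T_{s,m}^B,\nu_{\min}(\mathcal T_{s,m}^B,d),d]_q$ MFD code for every $d\in\{1,\dots,m+1\}\cup\{sm-1,sm\}$.
   Context: Notation: $[n]=\{1,\dots,n\}$, $[0]=\emptyset$. A (top-right justified) Ferrers diagram of order $n$ is a subset $\mathcal F\subseteq[n]^2$ such that (1) $(i,j)\in\mathcal F$ and $j<n$ imply $(i,j+1)\in\mathcal F$; (2) $(i,j)\in\mathcal F$ and $i>1$ imply $(i-1,j)\in\mathcal F$. Write $\mathcal F=[c_1,\dots,c_n]$ where $c_j$ is the number of elements of $\mathcal F$ in column $j$. For $d\in[n]$ and $j\in\{0,\dots,d-1\}$ let $\nu_j(\mathcal F,d)=\sum_{i=1}^{n-j}\max\{0,c_i-d+1+j\}$ and $\nu_{\min}(\mathcal F,d)=\min_{0\le j\le d-1}\nu_j(\mathcal F,d)$. Codes: $\mathbb F_q^{\mathcal F}$ is the space of $n\times n$ matrices over $\mathbb F_q$ whose entries outside the positions in $\mathcal F$ are zero. An $[\mathcal F,k,d]_q$ code is a $k$-dimensional $\mathbb F_q$-linear subspace of $\mathbb F_q^{\mathcal F}$ whose minimum rank over nonzero elements is $d$. It is an MFD (maximum Ferrers diagram) code if $k=\nu_{\min}(\mathcal F,d)$. The block triangular diagram of order $sm$ is $\mathcal T_{s,m}^B=\bigcup_{1\le i\le j\le s}Q_{i,j}$, where $Q_{i,j}=([im]\setminus[(i-1)m])\times([jm]\setminus[(j-1)m])$. *)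

(* Defs.v *)
From HB Require Import structures.
From mathcomp Require Import all_boot all_order all_algebra.

Set Implicit Arguments.
Unset Strict Implicit.
Unset Printing Implicit Defensive.

Import GRing.Theory.

(* Rows, columns and blocks are numbered from 0: the position (i, j) of [n]^2 *)
(* is represented by (i - 1, j - 1) : 'I_n * 'I_n.                            *)

Definition ferrers_diagram (n : nat) (D : {set 'I_n * 'I_n}) : Prop :=
  (forall i j j' : 'I_n, (i, j) \in D -> nat_of_ord j' = j.+1 -> (i, j') \in D)
  /\
  (forall i j i' : 'I_n, (i, j) \in D -> nat_of_ord i = i'.+1 -> (i', j) \in D).

Definition col_size (n : nat) (D : {set 'I_n * 'I_n}) (j : 'I_n) : nat :=
  #|[set i : 'I_n | (i, j) \in D]|.

(* Truncated subtraction implements max {0, c_i - d + 1 + j}. *)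
Definition nu (n : nat) (D : {set 'I_n * 'I_n}) (d j : nat) : nat :=
  \sum_(i < n | i < n - j) (col_size D i + 1 + j - d).

(* For d >= 1 the default value is the term of index j = 0. *)
Definition nu_min (n : nat) (D : {set 'I_n * 'I_n}) (d : nat) : nat :=
  \big[minn/nu D d 0]_(j < d) nu D d j.

Definition supported_on (F : finFieldType) (n : nat) (D : {set 'I_n * 'I_n})
    (A : 'M[F]_n) : Prop :=
  forall i j : 'I_n, (i, j) \notin D -> A i j = 0%R.

Definition min_rank (F : finFieldType) (n : nat) (C : {vspace 'M[F]_n})
    (d : nat) : Prop :=
  (exists A : 'M[F]_n, [/\ A \in C, A != 0%R & \rank A = d]) /\
  (forall A : 'M[F]_n, A \in C -> A != 0%R -> d <= \rank A).

Definition ferrers_code (F : finFieldType) (n : nat) (D : {set 'I_n * 'I_n})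
    (k d : nat) (C : {vspace 'M[F]_n}) : Prop :=
  [/\ forall A : 'M[F]_n, A \in C -> supported_on D A,
      \dim C = k
    & min_rank C d].

Definition mfd_code (F : finFieldType) (n : nat) (D : {set 'I_n * 'I_n})
    (k d : nat) (C : {vspace 'M[F]_n}) : Prop :=
  ferrers_code D k d C /\ k = nu_min D d.

Definition block (n m i j : nat) : {set 'I_n * 'I_n} :=
  [set x : 'I_n * 'I_n | (i * m <= x.1 < i.+1 * m) && (j * m <= x.2 < j.+1 * m)].

Definition block_triangular (s m : nat) : {set 'I_(s * m) * 'I_(s * m)} :=
  \bigcup_(i < s) \bigcup_(j < s | i <= j) block (s * m) m i j.

Lemma mem_block_triangular (s m : nat) (x : 'I_(s * m) * 'I_(s * m)) :
  (x \in block_triangular s m) = (x.1 %/ m <= x.2 %/ m).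
Proof.
have m_gt0 : 0 < m by case: m x => // -[] [i]; rewrite muln0.
have blkP (a i : nat) : (i * m <= a < i.+1 * m) = (a %/ m == i).
  by rewrite -leq_divRL // -ltn_divLR // ltnS andbC -eqn_leq.
apply/bigcupP/idP => [[i _ /bigcupP[j le_ij]]|le_x].
  by rewrite inE !blkP => /andP[/eqP-> /eqP->].
have ltx (a : 'I_(s * m)) : a %/ m < s by rewrite ltn_divLR.
exists (Ordinal (ltx x.1)) => //; apply/bigcupP.
by exists (Ordinal (ltx x.2)) => //; rewrite inE !blkP /= !eqxx.
Qed.

Lemma block_triangular_ferrers (s m : nat) :
  ferrers_diagram (block_triangular s m).
Proof.
split=> [i j j'|i j i']; rewrite !mem_block_triangular /= => le_ij e.
  by apply: leq_trans le_ij _; rewrite e leq_div2r.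
by apply: leq_trans le_ij; rewrite e leq_div2r.
Qed.

(* Main.v *)
Require Import Defs.
From HB Require Import structures.
From mathcomp Require Import all_boot all_order all_algebra.
From mathcomp Require Import all_fingroup all_field mxabelem zify ring.

Set Implicit Arguments.
Unset Strict Implicit.
Unset Printing Implicit Defensive.

Import GRing.Theory VectorInternalTheory.

(** Put n = s m and q = #|F|, and let L be the extension of F of degree l.
    A linearized polynomial sum_(i < k) a_i x^(q^i) over L is an F-linear
    endomorphism of L; having at most q^(k-1) roots, it has rank at least
    l - (k - 1) unless it is zero. Every code below is the injective image of
    a space of such polynomials (or of their values), so that its dimension is
    the dimension of the parameter space, and it contains an explicit matrix
    of rank exactly d. Matrices act on row vectors, on the right.

    d <= m + 1. The rows above row d - 1 lie entirely in the diagram, which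
    makes nu_0 the number of dots in the other rows and the least of the
    nu_j. Take l = n and k = n - d + 1. A linearized polynomial is determined
    by its values at k independent points, and these are arbitrary. Hence the
    k bottom rows of the matrix can be filled freely, in particular with any
    entries supported on the diagram, and the d - 1 remaining rows, over
    which there is no control, are unconstrained. This is the
    Etzion-Silberstein construction ([etzion_silberstein]).

    d = n and d = n - 1. Now l = m, and nu_min is m, respectively 2m, again
    attained by nu_0 ([nu_block_triangular_ge]). For d = n the matrices with all diagonal blocks equal to the
    multiplication by a in L do. For d = n - 1 the diagonal blocks are copies
    of A : x |-> a x + b x^q, whose kernel has dimension at most 1; alone they
    could lose one dimension of rank per block. So copies of
    B : x |-> - mu b x^q are put on the superdiagonal, where mu is not of the
    form z^q - z. If A x = 0 with x <> 0, the image of A is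
    { b x^q (z^q - z) | z in L }, which does not contain B x. As in a Jordan
    block, the s kernels are then linked so that only the last one survives
    ([bidiag_kernel]), and the rank is at least n - 1. Both cases are
    instances of [bidiag_code]. *)

(** * The numbers nu and their minimum *)

Lemma card_ord_lt n t : t <= n -> #|[set i : 'I_n | i < t]| = t.
Proof.
move=> tn; rewrite -[RHS]card_ord -sum1dep_card -sum1_card.
by rewrite [RHS](big_ord_widen_cond _ xpredT (fun=> 1) tn).
Qed.

Lemma col_size_split n (D : {set 'I_n * 'I_n}) t (j : 'I_n) : t <= n ->
    (forall i : 'I_n, i < t -> (i, j) \in D) ->
  col_size D j = t + #|[set i : 'I_n | ((i, j) \in D) && (t <= i)]|.
Proof.
move=> tn top; rewrite /col_size -(cardsID [set i : 'I_n | i < t]).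
congr (_ + _).
  rewrite -[RHS](card_ord_lt tn); apply: eq_card => i; rewrite !inE.
  by rewrite andbC; apply: andb_idr; apply: top.
by apply: eq_card => i; rewrite !inE -leqNgt andbC.
Qed.

(** Each of the d - 1 rows removed by the index j = 0 meets every column, so no
    truncation takes place in the sum. *)
Lemma nu0_card n (D : {set 'I_n * 'I_n}) d : 0 < d <= n ->
    (forall i j : 'I_n, i.+1 < d -> (i, j) \in D) ->
  nu D d 0 = #|[set x in D | d.-1 <= x.1]|.
Proof.
move=> /andP[d_gt0 dn] top; have tn : d.-1 <= n by lia.
have topt j (i : 'I_n) : i < d.-1 -> (i, j) \in D by move=> ?; apply: top; lia.
rewrite -sum1dep_card big_mkcond /=.
rewrite [RHS](eq_bigr (fun p : 'I_n * 'I_n =>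
  if ((p.1, p.2) \in D) && (d.-1 <= p.1) then 1 else 0)) => [|[]//].
rewrite -(pair_bigA _ (fun i j : 'I_n =>
  if ((i, j) \in D) && (d.-1 <= i) then 1 else 0)).
rewrite exchange_big /nu /=; apply: eq_big => [j|j _].
  by rewrite subn0 ltn_ord.
rewrite -big_mkcond sum1dep_card (col_size_split tn (topt j)).
by rewrite addn0 addn1 -addSn prednK ?addKn.
Qed.

Lemma nu_min_nu0 n (D : {set 'I_n * 'I_n}) d :
  (forall j, j < d -> nu D d 0 <= nu D d j) -> nu_min D d = nu D d 0.
Proof.
move=> le_nu; rewrite /nu_min; elim/big_rec: _ => // j x _ ->.
exact/minn_idPr/le_nu.
Qed.

(** Passing from the index 0 to j gives back j dots in each of the first n - j
    columns, and loses the last j columns, which contribute at most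
    n - d + 1 <= n - j each. *)
Lemma nu0_le_nu n (D : {set 'I_n * 'I_n}) d j : d <= n -> j < d ->
    (forall i j : 'I_n, i.+1 < d -> (i, j) \in D) ->
  nu D d 0 <= nu D d j.
Proof.
move=> dn jd top; have tn : d.-1 <= n by lia.
have topt l (i : 'I_n) : i < d.-1 -> (i, l) \in D by move=> ?; apply: top; lia.
have jn : n - j <= n by rewrite leq_subr.
have -> : nu D d 0 = \sum_(i < n) (col_size D i + 1 + 0 - d).
  by apply: eq_bigl => i; rewrite subn0 ltn_ord.
rewrite /nu (bigID (fun i : 'I_n => i < n - j)) /=.
have -> : \sum_(i < n | i < n - j) (col_size D i + 1 + j - d) =
    \sum_(i < n | i < n - j) (col_size D i + 1 + 0 - d) + (n - j) * j.
  rewrite -[X in _ = _ + X * j](card_ord_lt jn) -sum_nat_const.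
  rewrite [X in _ = _ + X](eq_bigl (fun i : 'I_n => i < n - j)) => [|i];
    last by rewrite inE.
  rewrite -big_split; apply: eq_bigr => i _ /=.
  by rewrite (col_size_split tn (topt i)); lia.
rewrite leq_add2l.
(* The gain is charged to the j lost columns, at n - j per column. *)
have -> : (n - j) * j = #|[set i : 'I_n | ~~ (i < n - j)]| * (n - j).
  rewrite mulnC; congr (_ * _).
  have := cardsC [set i : 'I_n | i < n - j]; rewrite card_ord_lt // card_ord.
  have -> : ~: [set i : 'I_n | i < n - j] = [set i : 'I_n | ~~ (i < n - j)].
    by apply/setP => i; rewrite !inE.
  lia.
rewrite -sum_nat_const.
rewrite [leqRHS](eq_bigl (fun i : 'I_n => ~~ (i < n - j))) => [|i];
  last by rewrite inE.
apply: leq_sum => i _; have : col_size D i <= n.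
  by rewrite -[leqRHS](card_ord n) max_card.
lia.
Qed.

Lemma col_size_block_triangular s m (j : 'I_(s * m)) :
  col_size (block_triangular s m) j = (j %/ m).+1 * m.
Proof.
have m_gt0 : 0 < m by case: m j => [|//] [j]; rewrite {1}muln0.
have jm : (j %/ m).+1 * m <= s * m.
  by rewrite leq_mul2r ltn_divLR ?ltn_ord ?orbT.
rewrite -[RHS](card_ord_lt jm); apply: eq_card => i.
by rewrite !inE mem_block_triangular /= -ltn_divLR // ltnS.
Qed.

Lemma nu_block_triangular s m d j :
  nu (block_triangular s m) d j =
  \sum_(0 <= i < s * m - j) ((i %/ m).+1 * m + 1 + j - d).
Proof.
rewrite big_mkord (big_ord_widen _ (fun i => (i %/ m).+1 * m + 1 + j - d)
  (leq_subr j (s * m))).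
by apply: eq_bigr => i _; rewrite col_size_block_triangular.
Qed.

(** Only the columns of the last block have more than d - 1 dots. *)
Lemma nu0_block_triangular s m e : 0 < s -> e < m ->
  nu (block_triangular s m) (s * m - e) 0 = e.+1 * m.
Proof.
move=> s_gt0 em; rewrite nu_block_triangular subn0.
rewrite (big_cat_nat (n := s.-1 * m)) //= ?leq_mul2r ?leq_pred ?orbT //.
have sE : s * m = s.-1 * m + m by rewrite -{1}(prednK s_gt0) mulSnr.
rewrite big_nat big1 => [|i /andP[_ i_lt]]; last first.
  have : i %/ m < s.-1 by rewrite ltn_divLR //; lia.
  by rewrite -(leq_pmul2r (m := m)); lia.
rewrite add0n (eq_big_nat _ _ (F2 := fun=> e.+1)) => [|i /andP[le_i i_lt]].
  by rewrite sum_nat_const_nat sE addKn mulnC.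
have -> : i %/ m = s.-1.
  apply/eqP; rewrite eqn_leq leq_divRL ?(leq_trans _ em) // le_i andbT.
  by rewrite -ltnS prednK // ltn_divLR ?i_lt //; lia.
by rewrite prednK //; lia.
Qed.

(** Of the t = n - j columns that are kept, the last ones form a piece of r
    columns of one block and contribute r (m + 1 + e - r), which is at least
    (e + 1) m when e < r <= m. For e = r = 1 this falls short by m - 1, and the
    preceding block supplies m more. *)
Lemma nu_block_triangular_ge s m e j : e < 2 -> 1 < m -> j < s * m - e ->
  e.+1 * m <= nu (block_triangular s m) (s * m - e) j.
Proof.
move=> e2 m1 jd; rewrite nu_block_triangular; set t := s * m - j.
have et : e < t by rewrite /t; lia.
have termE i : (i %/ m).+1 * m + 1 + j - (s * m - e) =
    (i %/ m).+1 * m + 1 + e - t.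
  by rewrite /t; lia.
under eq_big_nat do rewrite termE.
(* a is the block of the last column kept. *)
pose a := t.-1 %/ m; pose r := t - a * m.
have tE : t.-1 = a * m + t.-1 %% m by exact: divn_eq.
have rm : t.-1 %% m < m by rewrite ltn_mod; lia.
have rE : r = (t.-1 %% m).+1 by rewrite /r; lia.
have tr : t = a * m + r by rewrite rE; lia.
rewrite (big_cat_nat (n := a * m)) //=; last by lia.
have -> : \sum_(a * m <= i < t) ((i %/ m).+1 * m + 1 + e - t) =
    r * (m + 1 + e - r).
  rewrite (eq_big_nat _ _ (F2 := fun=> m + 1 + e - r)) => [|i /andP[ai it]].
    by rewrite sum_nat_const_nat tr addKn.
  suff -> : i %/ m = a by rewrite mulSn; lia.
  apply/eqP; rewrite eqn_leq leq_divRL ?ai ?andbT //; last by lia.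
  by rewrite -ltnS ltn_divLR ?mulSn; lia.
have [er|] := ltnP e r.
  apply: leq_trans (leq_addl _ _).
  have e01 : e = 0 \/ e = 1 by lia.
  by case: e01 er => -> er; nia.
move=> re; have [e1 r1] : e = 1 /\ r = 1 by lia.
have a_gt0 : 0 < a by rewrite lt0n; apply/eqP => a0; move: tr; rewrite a0; lia.
have : m <= \sum_(0 <= i < a * m) ((i %/ m).+1 * m + 1 + e - t).
  have am : a.-1 * m <= a * m by rewrite leq_mul2r leq_pred orbT.
  rewrite (big_cat_nat (n := a.-1 * m)) //=; apply: leq_trans (leq_addl _ _).
  have aE : a * m = a.-1 * m + m by rewrite -{1}(prednK a_gt0) mulSnr.
  rewrite -{1}[m]muln1 -{1}(addKn (a.-1 * m) m) -aE -sum_nat_const_nat.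
  rewrite big_nat [leqRHS]big_nat; apply: leq_sum => i /andP[ai it].
  have : a <= (i %/ m).+1.
    by rewrite -{1}(prednK a_gt0) ltnS leq_divRL //; lia.
  by rewrite -(leq_pmul2r (m := m)); lia.
by rewrite e1 r1 => ?; lia.
Qed.

Local Open Scope ring_scope.

(** * Linearized polynomials over an extension of given degree *)

(** The splitting field of X^(q^n) - X: the polynomial is separable, and its
    roots, being the fixed points of a power of the Frobenius automorphism,
    form a subfield, so they are the whole field, which has q^n elements. *)
Lemma exists_fieldExt_dim (F : finFieldType) (n : nat) :
  (0 < n)%N -> exists L : fieldExtType F, dim L = n.
Proof.
move=> n_gt0; pose q := #|F|; pose Q := (q ^ n)%N.
have [p p_pr pcharF] := finPcharP F.
have Qpnat : p.-nat Q.
  by rewrite /Q pnatX /q (card_pprimeChar pcharF) pnatX pnat_id.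
have q_gt1 : (1 < q)%N by apply: finNzRing_gt1.
have Q_gt1 : (1 < Q)%N by rewrite -(exp1n n) ltn_exp2r.
have pQ : (p %| Q)%N.
  have := Q_gt1; rewrite -(part_pnat_id Qpnat) p_part.
  by case: (logn p Q) => // e _; rewrite expnS dvdn_mulr.
pose P (R : nzRingType) : {poly R} := 'X^Q - 'X.
have sP R : size (P R) = Q.+1.
  by rewrite /P size_polyDl size_polyXn // size_polyN size_polyX ltnS.
have /FinSplittingFieldFor[/= L splitL] : P F != 0.
  by rewrite -size_poly_eq0 sP.
rewrite [map_poly _ _]rmorphB rmorphXn /= map_polyX -/(P L) in splitL.
have [zs DP defL] := splitL.
have pcharL : p \in [pchar L] by rewrite pchar_lalg.
have Uzs : uniq zs.
  rewrite -separable_prod_XsubC -(eqp_separable DP) unlock.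
  rewrite /P derivB derivXn derivX -mulr_natl.
  have -> : Q%:R = 0 :> {poly L}.
    have [e ->] := dvdnP pQ.
    by rewrite natrM -[p%:R]polyC_natr (pcharf0 pcharL) polyC0 mulr0.
  rewrite mul0r sub0r coprimep_sym -(coprimepZl _ _ (c := -1)).
    by rewrite scaleN1r opprK coprime1p.
  by rewrite oppr_eq0 oner_eq0.
have [alpha _ Dalpha] := finField_galois_generator (sub1v {:L}).
have {}Dalpha x : alpha x = x ^+ q by rewrite Dalpha ?memvf // dimv1 expn1.
pose E := fixedSpace (alpha ^+ n)%g.
have in_zs : zs =i E.
  move=> z; rewrite -root_prod_XsubC -(eqp_root DP) (sameP fixedSpaceP eqP).
  rewrite /root /P !hornerE subr_eq0 /= /Q; congr (_ == z).
  elim: (n) => [|i IHi]; first by rewrite gal_id.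
  by rewrite expgSr expnSr exprM IHi galM ?Dalpha ?memvf.
have defE : E = {:L}%VS.
  apply/eqP; rewrite eqEsubv subvf -defL -[E]subfield_closed agenvS //.
  by rewrite subv_add sub1v; apply/span_subvP=> z; rewrite in_zs.
exists L; rewrite -dimvf; apply/eqP; rewrite -(eqn_exp2l _ _ q_gt1) -/Q.
pose fL : finFieldType := FinFieldExtType L.
have cardL : #|fL| = (#|F| ^ \dim {:L})%N.
  rewrite -[RHS](@card_vspace F fL (Vector.class (finvect_type L)) {:L}%VS).
  by apply: eq_card => x; rewrite memvf.
rewrite -/q -cardL; apply/eqP/succn_inj.
rewrite -(sP L) (eqp_size DP) size_prod_XsubC.
congr _.+1; rewrite -(card_uniqP (Uzs : @uniq fL zs)).
by apply: eq_card => x; rewrite (in_zs x) defE memvf.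
Qed.

Section Frobenius.
Variables (F : finFieldType) (L : fieldExtType F).

Lemma frobenius_linear i : linear (fun x : L => x ^+ (#|F| ^ i)).
Proof.
move=> c x y; have [p p_pr pF] := finPcharP F.
have pL : p \in [pchar L] by rewrite pchar_lalg.
rewrite exprDn_pchar; last first.
  rewrite (eq_pnat _ (pcharf_eq pL)).
  by rewrite pnatX (card_pprimeChar pF) pnatX pnat_id.
congr (_ + _); rewrite exprZn; congr (_ *: _).
by elim: i => [|i IHi]; rewrite ?expr1 // expnSr exprM IHi expf_card.
Qed.

Definition linpoly k (a : {ffun 'I_k -> L}) (x : L) : L :=
  \sum_(i < k) a i * x ^+ (#|F| ^ i).

Lemma linpoly_linear k (a : {ffun 'I_k -> L}) : linear (linpoly a).
Proof.
move=> c x y; rewrite /linpoly scaler_sumr -big_split; apply: eq_bigr => i _ /=.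
by rewrite frobenius_linear mulrDr -scalerAr.
Qed.

HB.instance Definition _ k (a : {ffun 'I_k -> L}) :=
  GRing.isLinear.Build F L L _ (linpoly a) (linpoly_linear a).

Lemma linpoly_linearl k (x : L) :
  linear (fun a : {ffun 'I_k -> L} => linpoly a x).
Proof.
move=> c a b; rewrite /linpoly scaler_sumr -big_split; apply: eq_bigr => i _ /=.
by rewrite !ffunE mulrDl scalerAl.
Qed.

Lemma linpoly_roots k (a : {ffun 'I_k -> L}) : a != 0 ->
  exists2 P : {poly L}, P != 0 /\ (size P <= (#|F| ^ k.-1).+1)%N
                       & forall x, linpoly a x = 0 -> root P x.
Proof.
move=> a_neq0; have q_gt1 := finNzRing_gt1 F.
pose P : {poly L} := \sum_(i < k) a i *: 'X^(#|F| ^ i).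
have evP x : P.[x] = linpoly a x.
  by rewrite horner_sum; apply: eq_bigr => i _; rewrite !hornerE.
exists P; last by move=> x; rewrite /root evP => ->.
split.
  apply: contra_neq a_neq0 => P0; apply/ffunP => i; rewrite ffunE.
  have := coef0 L (#|F| ^ i); rewrite -P0 coef_sum (bigD1 i) //= big1 ?addr0.
    by rewrite coefZ coefXn eqxx mulr1.
  move=> j ji; rewrite coefZ coefXn eqn_exp2l // val_eqE eq_sym (negPf ji).
  by rewrite mulr0.
apply: leq_trans (size_sum _ _ _) _; apply/bigmax_leqP => i _.
rewrite (leq_trans (size_scale_leq _ _)) // size_polyXn ltnS leq_exp2l //.
by rewrite -ltnS prednK // (leq_trans _ (ltn_ord i)).
Qed.

(** A row kernel of dimension c has q^c elements, so embedding it in the root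
    set of a polynomial of degree at most q^r gives c <= r. *)
Lemma rank_ge_of_roots n (M : 'M[F]_n) (phi : 'rV[F]_n -> L) (P : {poly L}) r :
    P != 0 -> (size P <= (#|F| ^ r).+1)%N ->
    (forall u, u *m M = 0 -> root P (phi u)) ->
    {in [pred u | u *m M == 0] &, injective phi} ->
  (n <= \rank M + r)%N.
Proof.
move=> P0 sP kerP inj; rewrite -leq_subLR -mxrank_ker.
rewrite -(leq_exp2l _ _ (finNzRing_gt1 F)) -card_rowg -ltnS.
apply: leq_trans sP; rewrite cardE -(size_map phi).
have inK u : (u \in enum (rowg (kermx M))) = (u *m M == 0).
  by rewrite mem_enum inE; apply/sub_kermxP/eqP.
apply: max_poly_roots => //.
  by apply/allP => _ /mapP[u uK ->]; apply/kerP/eqP; rewrite -inK.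
by rewrite map_inj_in_uniq ?enum_uniq // => u v; rewrite !inK; apply: inj.
Qed.

Definition endo_mx (g : L -> L) : 'M[F]_(dim L) := lin1_mx (v2r \o g \o r2v).

Lemma row_endo_mx (g : L -> L) i :
  row i (endo_mx g) = v2r (g (r2v (delta_mx 0 i))).
Proof. by apply/rowP => j; rewrite !mxE. Qed.

Lemma mul_endo_mx (g : {linear L -> L}) u : u *m endo_mx g = v2r (g (r2v u)).
Proof. by rewrite mul_rV_lin1. Qed.

Lemma rank_linpoly k (a : {ffun 'I_k -> L}) : a != 0 ->
  (dim L <= \rank (endo_mx (linpoly a)) + k.-1)%N.
Proof.
move=> /linpoly_roots[P [P0 sP] rootP].
apply: (rank_ge_of_roots (phi := r2v) P0 sP) => [u|]; last first.
  by move=> u v _ _; apply: (can_inj r2vK).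
rewrite mul_endo_mx => /(congr1 r2v); rewrite v2rK linear0.
exact: rootP.
Qed.

End Frobenius.

(** * Codes given by an encoder *)

Lemma rank_le_zero_rows (F : fieldType) n d (M : 'M[F]_n) :
  (forall i : 'I_n, (d <= i)%N -> row i M = 0) -> (\rank M <= d)%N.
Proof.
move=> M0; have -> : M = (pid_mx d : 'M_n) *m M.
  apply/row_matrixP => i; rewrite row_mul; case: (ltnP i d) => id.
    suff -> : row i (pid_mx d : 'M[F]_n) = delta_mx 0 i by rewrite -rowE.
    by apply/rowP => j; rewrite !mxE id andbT eqxx eq_sym.
  rewrite M0 //; suff -> : row i (pid_mx d : 'M[F]_n) = 0 by rewrite mul0mx.
  by apply/rowP => j; rewrite !mxE ltnNge id andbF.
apply: leq_trans (mxrankM_maxl _ _) _.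
case: (leqP d n) => dn; first by rewrite rank_pid_mx.
exact: leq_trans (rank_leq_row _) (ltnW dn).
Qed.

(** The rank bound makes the encoder injective, as a nonzero word cannot have
    rank 0. *)
Lemma ferrers_code_of_encoder (F : finFieldType) n (D : {set 'I_n * 'I_n}) d
    (U : vectType F) (f : {linear U -> 'M[F]_n}) : (0 < d)%N ->
    (forall u, supported_on D (f u)) ->
    (forall u, u != 0 -> (d <= \rank (f u))%N) ->
    (exists2 u, u != 0 & (\rank (f u) <= d)%N) ->
  exists C : {vspace 'M[F]_n}, ferrers_code D (\dim {:U}) d C.
Proof.
move=> d_gt0 suppf rankf [u0 u0_neq0 rank0].
have f_neq0 u : u != 0 -> f u != 0.
  by move=> /rankf; apply: contraTneq => ->; rewrite mxrank0 -ltnNge.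
exists (limg (linfun f)); split.
- by move=> A /memv_imgP[u _ ->]; rewrite lfunE.
- apply: limg_dim_eq; apply/eqP; rewrite -subv0; apply/subvP => u.
  rewrite memv_cap memv_ker lfunE memv0 => /andP[_].
  by apply: contraTT => /f_neq0.
split=> [|A /memv_imgP[u _ ->]].
  exists (f u0); split; [|exact: f_neq0|].
    by rewrite -[f u0]lfunE memv_img ?memvf.
  by apply/eqP; rewrite eqn_leq rank0 rankf.
rewrite lfunE => fu; apply: rankf.
by apply: contraNneq fu => ->; rewrite linear0.
Qed.

(** * The Etzion-Silberstein construction *)

(** A systematic encoder for the matrices of linearized polynomials with
    k = n - t coefficients: the k rows below the top t ones carry the
    information. *)
Section SystematicGabidulin.
Variables (F : finFieldType) (L : fieldExtType F) (t : nat).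
Local Notation n := (dim L).
Local Notation k := (n - t)%N.

Lemma bottom_subproof (i : 'I_k) : (t + i < n)%N.
Proof. by rewrite -ltn_subRL. Qed.
Definition bottom (i : 'I_k) : 'I_n := Ordinal (bottom_subproof i).

Lemma bottomP (x : 'I_n) : (t <= x)%N -> exists i, x = bottom i.
Proof.
move=> tx; have xk : (x - t < k)%N by rewrite ltn_sub2r // (leq_ltn_trans tx).
by exists (Ordinal xk); apply: val_inj; rewrite /= subnKC.
Qed.

Definition bottom_eval (a : {ffun 'I_k -> L}) : {ffun 'I_k -> L} :=
  [ffun i => linpoly a (r2v (delta_mx 0 (bottom i)))].

Lemma bottom_eval_linear : linear bottom_eval.
Proof. by move=> c a b; apply/ffunP => i; rewrite !ffunE linpoly_linearl. Qed.

HB.instance Definition _ :=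
  GRing.isLinear.Build F _ _ _ bottom_eval bottom_eval_linear.

(** If k rows of the matrix of a nonzero polynomial with k coefficients
    vanished, its rank would be at most n - k, below the bound
    n - (k - 1). *)
Lemma bottom_eval_inj : lker (linfun bottom_eval) == 0%VS.
Proof.
rewrite -subv0; apply/subvP => a; rewrite memv_ker lfunE memv0 => /eqP ev0.
(* For k = 0 the truncated k.-1 spoils the rank bound. *)
have [k0|k_gt0] := posnP k.
  by apply/eqP/ffunP => i; have := ltn_ord i; rewrite {2}k0.
apply: contraLR k_gt0 => /rank_linpoly; rewrite -leqNgt leqn0 -/n => rk.
have tn : (\rank (endo_mx (linpoly a)) <= t)%N.
  apply: rank_le_zero_rows => i /bottomP[j ->]; rewrite row_endo_mx.
  by move/ffunP/(_ j): ev0; rewrite !ffunE => ->; rewrite linear0.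
lia.
Qed.

Definition bottom_interp (b : {ffun 'I_k -> L}) : {ffun 'I_k -> L} :=
  (linfun bottom_eval)^-1%VF b.

Lemma bottom_interpK b : bottom_eval (bottom_interp b) = b.
Proof. by have := lker0_lfunVK bottom_eval_inj b; rewrite lfunE. Qed.

Variable D : {set 'I_n * 'I_n}.
Local Notation dot := {x : 'I_n * 'I_n | x \in [set x in D | t <= x.1]%N}.

Definition filled_row (w : {ffun dot -> F^o}) (i : 'I_n) : 'rV[F]_n :=
  \row_j oapp w 0 (insub (i, j)).

Definition encoder (w : {ffun dot -> F^o}) : 'M[F]_n :=
  endo_mx (linpoly (bottom_interp [ffun i => r2v (filled_row w (bottom i))])).

Lemma encoder_linear : linear encoder.
Proof.
move=> c w1 w2; apply/row_matrixP => x; rewrite linearP /= !row_endo_mx.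
rewrite -linearP -linpoly_linearl; congr (v2r (linpoly _ _)).
rewrite /bottom_interp -linearP; congr (_ _); apply/ffunP => i; rewrite !ffunE.
rewrite -linearP; congr r2v; apply/rowP => j; rewrite !mxE.
by case: insub => [y|] /=; rewrite ?ffunE // mulr0 addr0.
Qed.

HB.instance Definition _ :=
  GRing.isLinear.Build F _ _ _ encoder encoder_linear.

Lemma row_encoder w (i : 'I_n) :
  (t <= i)%N -> row i (encoder w) = filled_row w i.
Proof.
move=> /bottomP[j ->]; rewrite row_endo_mx.
have /ffunP/(_ j) := bottom_interpK [ffun i => r2v (filled_row w (bottom i))].
by rewrite !ffunE => ->; rewrite r2vK.
Qed.

End SystematicGabidulin.

(** The dot in row d - 1 provides a word of rank at most d: filling that dot
    alone leaves only the d top rows nonzero. *)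
Lemma etzion_silberstein (F : finFieldType) n (D : {set 'I_n * 'I_n}) d :
    (0 < d <= n)%N ->
    (forall i j : 'I_n, (i.+1 < d)%N -> (i, j) \in D) ->
    (exists2 x, x \in D & (nat_of_ord x.1).+1 = d) ->
  exists C : {vspace 'M[F]_n}, 
    ferrers_code D #|[set x in D | (d.-1 <= x.1)%N]| d C.
Proof.
case/andP=> d_gt0 d_le_n; move: D (d_le_n).
have [L <-] := exists_fieldExt_dim F (leq_trans d_gt0 d_le_n).
move=> D {}d_le_n top [x0 x0D x0d].
pose t := d.-1; pose S := [set x in D | (t <= x.1)%N].
have x0S : x0 \in S by rewrite inE x0D -ltnS x0d /t prednK /=.
pose dot := {x | x \in S}.
have -> : #|S| = \dim {: {ffun dot -> F^o}}.
  by rewrite dimvf /dim /= muln1 card_sig.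
apply: (ferrers_code_of_encoder (f := @encoder F L t D)) => //.
- move=> w i j ijD; have ti : (t <= i)%N.
    rewrite leqNgt; apply: contra ijD => it; apply: top.
    by rewrite /t in it; lia.
  have /rowP/(_ j) := row_encoder w ti; rewrite !mxE => ->.
  by rewrite insubN // inE (negPf ijD).
- move=> w w0.
  have : bottom_interp (t := t) [ffun i => r2v (filled_row w (bottom i))] != 0.
    apply/eqP => b0; case/eqP: w0.
    have enc0 : encoder w = 0.
      apply/row_matrixP => i; rewrite row_endo_mx b0 row0 /linpoly.
      by rewrite big1 ?linear0 // => l _; rewrite ffunE mul0r.
    apply/ffunP => -[[i j] ijS]; have:= ijS; rewrite inE => /andP[_ ti].
    have /rowP/(_ j) := row_encoder w ti.
    by rewrite enc0 row0 !mxE insubT /= ffunE => <-.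
  move/rank_linpoly; rewrite -/(encoder w) /= /t; move: (\rank _) => r; lia.
exists ([ffun y => (val y == x0)%:R] : {ffun dot -> F^o}).
  apply/eqP => /ffunP/(_ (Sub x0 x0S)); rewrite !ffunE /= eqxx => /eqP.
  by rewrite oner_eq0.
apply: rank_le_zero_rows => i di; rewrite row_encoder; last by rewrite /t; lia.
apply/rowP => j; rewrite !mxE; case: insubP => //= y _ yE; rewrite ffunE yE.
by case: eqP => // ijE; move: di; rewrite -x0d -ijE ltnn.
Qed.

(** * Block bidiagonal matrices *)

Lemma index_allpairs_pair (T1 T2 : eqType) (s : seq T1) (t : seq T2) x y :
    x \in s -> y \in t ->
  index (x, y) [seq (x, y) | x <- s, y <- t] =
    (index x s * size t + index y t)%N.
Proof.
move=> + yt; elim: s => //= z s IHs; rewrite inE eq_sym index_cat.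
case: eqP => [-> _|/eqP zx /= xs].
  by rewrite map_f // index_map // => ? ? [].
rewrite ifF; last by apply/mapP => -[w _ [xz]]; rewrite xz eqxx in zx.
by rewrite size_map IHs // mulSn addnA.
Qed.

Lemma val_mxvec_index m n (i : 'I_m) (j : 'I_n) :
  mxvec_index i j = (i * n + j)%N :> nat.
Proof.
transitivity (index (i, j) (enum {: 'I_m * 'I_n})).
  rewrite -[X in index X](nth_enum_rank (i, j)) index_uniq ?enum_uniq //.
  by rewrite -cardE ltn_ord.
rewrite enumT unlock /= index_allpairs_pair ?mem_enum //.
by rewrite !index_enum_ord size_enum_ord.
Qed.

Lemma mxvec_index_div m n (i : 'I_m) (j : 'I_n) : (mxvec_index i j %/ n = i)%N.
Proof.
rewrite val_mxvec_index divnMDl ?divn_small ?addn0 //.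
exact: leq_ltn_trans (ltn_ord j).
Qed.

(** A row vector of length s m is viewed as a matrix of size s x m, whose rows
    are the coordinates of s elements of L. Matrices of order s m then come
    from linear maps, and composing with a vector requires no splitting of
    sums into blocks. *)
Section BlockBidiagonal.
Variables (F : finFieldType) (L : fieldExtType F) (s : nat).
Local Notation m := (dim L).
Implicit Types (A B : L -> L) (V : 'M[F]_(s, m)).

Definition block_entry V (i : 'I_s) : L := r2v (row i V).

Definition bidiag_map A B V : 'M[F]_(s, m) :=
  \matrix_(j < s) v2r (A (block_entry V j) +
     \sum_(i < s | i.+1 == j :> nat) B (block_entry V i)).

Lemma bidiag_map_linear (A B : {linear L -> L}) : linear (bidiag_map A B).
Proof.
move=> c V W; apply/row_matrixP => j; rewrite linearP /= !rowK -linearP /=.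
rewrite scalerDr addrACA scaler_sumr -big_split /block_entry /= !linearP.
by congr (v2r (_ + _)); apply: eq_bigr => i _; rewrite !linearP.
Qed.
HB.instance Definition _ (A B : {linear L -> L}) :=
  GRing.isLinear.Build F _ _ _ (bidiag_map A B) (bidiag_map_linear A B).

Definition bidiag_mx A B : 'M[F]_(s * m) := lin_mx (bidiag_map A B).

Lemma mul_bidiag_mx (A B : {linear L -> L}) V :
  mxvec V *m bidiag_mx A B = mxvec (bidiag_map A B V).
Proof. exact: mul_vec_lin. Qed.

Lemma block_entry_delta i j a :
  block_entry (delta_mx i a) j = if j == i then r2v (delta_mx 0 a) else 0.
Proof.
rewrite /block_entry; case: eqP => [->|/eqP ji].
  by congr r2v; apply/rowP => b; rewrite !mxE eqxx.
rewrite -[RHS](linear0 r2v); congr r2v; apply/rowP => b.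
by rewrite !mxE (negPf ji).
Qed.

Lemma bidiag_mxE (A B : {linear L -> L}) i j a b :
  bidiag_mx A B (mxvec_index i a) (mxvec_index j b) =
  v2r ((if i == j then A (r2v (delta_mx 0 a)) else 0)
       + (if i.+1 == j :> nat then B (r2v (delta_mx 0 a)) else 0)) 0 b.
Proof.
rewrite mxE /= vec_mx_delta mxvecE mxE block_entry_delta eq_sym.
congr ((v2r (_ + _)) _ _); first by case: eqP => // _; rewrite linear0.
under eq_bigr do rewrite block_entry_delta.
case: ifP => ij.
  rewrite (bigD1 i) //= eqxx big1 ?addr0 // => l /andP[_ /negPf->].
  by rewrite linear0.
rewrite big1 // => l lj; case: eqP => [li|_]; last by rewrite linear0.
by rewrite -li lj in ij.
Qed.

Lemma bidiag_mx_supported (A B : {linear L -> L}) :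
  supported_on (block_triangular s m) (bidiag_mx A B).
Proof.
move=> x y; case/mxvec_indexP: x => i a; case/mxvec_indexP: y => j b.
rewrite mem_block_triangular !mxvec_index_div -ltnNge bidiag_mxE => ji.
case: eqP => [ij|_]; first by rewrite ij ltnn in ji.
case: eqP => [ij|_]; first by rewrite -ij ltnNge leqnSn in ji.
by rewrite addr0 linear0 mxE.
Qed.

End BlockBidiagonal.

(** * The codes of minimum rank n and n - 1 *)

Section BidiagonalCode.
Variables (F : finFieldType) (L : fieldExtType F) (s : nat).
Local Notation m := (dim L).

(** Block i + 1 of the image is A x_(i+1) + B x_i, which forces x_i = 0 as soon
    as A x_i = 0; and A x_i is block i of the image once x_(i-1) = 0. The last
    block has no successor, which leaves the kernel of A there. *)
Lemma bidiag_kernel (A B : {linear L -> L}) (V : 'M[F]_(s, m)) :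
    (forall x y, x != 0 -> A x = 0 -> A y + B x != 0) ->
    bidiag_map A B V = 0 ->
  forall i : 'I_s, A (block_entry V i) = 0
                   /\ ((i.+1 < s)%N -> block_entry V i = 0).
Proof.
move=> AB ker i.
have eqn (j : 'I_s) : A (block_entry V j) +
    \sum_(l < s | l.+1 == j :> nat) B (block_entry V l) = 0.
  apply: (can_inj v2rK); rewrite linear0.
  by move/row_matrixP/(_ j): ker; rewrite rowK row0.
have [k] := ubnP (i : nat); elim: k i => // k IHk i; rewrite ltnS => ik.
have Ai : A (block_entry V i) = 0.
  have := eqn i; rewrite big1 ?addr0 // => l /eqP li.
  by rewrite (IHk l _).2 ?linear0 // li.
split=> // i1_lt_s; have := eqn (Ordinal i1_lt_s).
rewrite (big_pred1 i) => [|l]; last by rewrite /= eqSS.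
have [//|x_neq0 /eqP] := eqVneq (block_entry V i) 0.
by rewrite (negPf (AB _ _ _ _)).
Qed.

Variables (k : nat) (c : 'I_k -> L).

(** The superdiagonal block has to depend linearly on the coefficients a of the
    diagonal one, for the words to form a vector space; multiplying each
    coefficient by a constant is enough. *)
Definition twist (a : {ffun 'I_k -> L}) : {ffun 'I_k -> L} :=
  [ffun i => c i * a i].

Definition bidiag_enc (a : {ffun 'I_k -> L}) : 'M[F]_(s * m) :=
  bidiag_mx s (linpoly a) (linpoly (twist a)).

Lemma bidiag_enc_linear : linear bidiag_enc.
Proof.
move=> e a b; apply/matrixP => x y.
case/mxvec_indexP: x => i p; case/mxvec_indexP: y => j r.
rewrite [RHS]mxE [X in _ = X + _]mxE /bidiag_enc !bidiag_mxE.
have -> : twist (e *: a + b) = e *: twist a + twist b.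
  by apply/ffunP => l; rewrite !ffunE mulrDr scalerAr.
rewrite /= !linpoly_linearl; set u := r2v _.
by do 2!case: ifP => _; rewrite !linearD ?linear0 ?linearZ /= !mxE; ring.
Qed.

HB.instance Definition _ :=
  GRing.isLinear.Build F _ _ _ bidiag_enc bidiag_enc_linear.

Hypothesis s_gt0 : (0 < s)%N.
Hypothesis twistP : forall (a : {ffun 'I_k -> L}) (x y : L),
  a != 0 -> x != 0 -> linpoly a x = 0 ->
  linpoly a y + linpoly (twist a) x != 0.

Lemma rank_bidiag_enc a : a != 0 -> (s * m <= \rank (bidiag_enc a) + k.-1)%N.
Proof.
move=> a_neq0; have [P [P0 sP] rootP] := linpoly_roots a_neq0.
have last_lt : (s.-1 < s)%N by rewrite prednK.
pose last := Ordinal last_lt.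
have kerE u : u *m bidiag_enc a = 0 ->
    bidiag_map (linpoly a) (linpoly (twist a)) (vec_mx u) = 0.
  by move=> u0; apply: (can_inj mxvecK); rewrite linear0 -u0 -{2}[u]vec_mxK
    mul_bidiag_mx.
have kerP u (u0 : u *m bidiag_enc a = 0) :=
  bidiag_kernel (fun x y => twistP y a_neq0) (kerE u u0).
apply: (rank_ge_of_roots (phi := fun u => block_entry (vec_mx u) last) P0 sP).
  by move=> u u0; apply: rootP; exact: (kerP u u0 last).1.
move=> u v; rewrite !inE => /eqP u0 /eqP v0 uv.
apply: (can_inj vec_mxK); apply/row_matrixP => i; apply: (can_inj r2vK).
rewrite -![r2v _]/(block_entry _ i).
have [i1_lt_s|] := boolP (i.+1 < s)%N.
  by rewrite (kerP u u0 i).2 ?(kerP v v0 i).2.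
rewrite -leqNgt => i_ge; suff -> : i = last by [].
by apply: val_inj; have := ltn_ord i; rewrite /=; lia.
Qed.

Lemma bidiag_code : (k.-1 < s * m)%N ->
    (exists2 a, a != 0 & (\rank (bidiag_enc a) <= s * m - k.-1)%N) ->
  exists C : {vspace 'M[F]_(s * m)},
    ferrers_code (block_triangular s m) (k * m) (s * m - k.-1) C.
Proof.
move=> k_small ex.
have -> : (k * m)%N = \dim {: {ffun 'I_k -> L}}.
  by rewrite dimvf /dim /= card_ord.
apply: (ferrers_code_of_encoder (f := bidiag_enc)) => //.
- by rewrite subn_gt0.
- by move=> a; apply: bidiag_mx_supported.
- by move=> a /rank_bidiag_enc; rewrite leq_subLR addnC.
Qed.

End BidiagonalCode.

(** With one coefficient the diagonal block is the multiplication by a, already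
    injective, and nothing is needed on the superdiagonal. *)
Lemma full_rank_code (F : finFieldType) s m : (0 < s)%N -> (0 < m)%N ->
  exists C : {vspace 'M[F]_(s * m)},
    ferrers_code (block_triangular s m) m (s * m) C.
Proof.
move=> s_gt0 m_gt0; have [L Lm] := exists_fieldExt_dim F m_gt0.
rewrite -Lm in m_gt0 *.
have [|||C] := @bidiag_code F L s 1 (fun=> 0) s_gt0.
- move=> a x y a0 x0; rewrite /linpoly big_ord1 expr1 => /eqP.
  rewrite mulf_eq0 (negPf x0) orbF => /eqP a00; case/eqP: a0.
  by apply/ffunP => i; rewrite ord1 a00 ffunE.
- by rewrite muln_gt0 s_gt0.
- exists [ffun=> 1]; last by rewrite subn0 rank_leq_row.
  by apply/eqP => /ffunP/(_ ord0)/eqP; rewrite !ffunE oner_eq0.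
by rewrite subn0 mul1n => CP; exists C.
Qed.

(** An F-linear endomorphism that kills 1 is not injective, hence not
    surjective. *)
Lemma frobenius_sub_id_not_surj (F : finFieldType) (L : fieldExtType F) :
  exists mu : L, forall z, z ^+ #|F| - z != mu.
Proof.
pose f : L -> L := linpoly [ffun i : 'I_2 => if i == ord0 then -1 else 1].
have fE z : f z = z ^+ #|F| - z.
  by rewrite /f /linpoly big_ord_recl big_ord1 !ffunE /= mulN1r mul1r addrC.
pose g := linfun f.
have g1 : g 1 = 0 by rewrite lfunE [LHS]fE expr1n subrr.
have : limg g != fullv.
  apply/negP => /eqP gfull; have := limg_ker_dim g fullv.
  rewrite capfv gfull -[RHS]add0n => /addIn/eqP; rewrite dimv_eq0 -subv0.
  move/subvP/(_ 1); rewrite memv_ker g1 eqxx memv0.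
  by rewrite oner_eq0 => /(_ isT).
rewrite eqEsubv subvf /= => /subvPn[mu _ mu_notin]; exists mu => z.
by apply: contraNneq mu_notin => <-; rewrite -fE -[f z]lfunE memv_img ?memvf.
Qed.

(** If a x + b x^q = 0 with x <> 0, then a = - b x^q / x, and substituting
    y = x z turns a y + b y^q - mu b x^q into b x^q (z^q - z - mu). The rank
    n - 1 is attained for x^q - x, up to sign, which kills 1: the vector with
    1 in the last block and 0 elsewhere lies in the kernel. *)
Lemma corank_one_code (F : finFieldType) s m : (0 < s)%N -> (1 < m)%N ->
  exists C : {vspace 'M[F]_(s * m)},
    ferrers_code (block_triangular s m) (2 * m) (s * m - 1) C.
Proof.
move=> s_gt0 m_gt1; have [L Lm] := exists_fieldExt_dim F (ltnW m_gt1).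
rewrite -Lm in m_gt1 *.
have [mu muP] := frobenius_sub_id_not_surj L.
have lin2E (a : {ffun 'I_2 -> L}) x :
    linpoly a x = a ord0 * x + a ord_max * x ^+ #|F|.
  rewrite /linpoly big_ord_recl big_ord1 expr1; congr (_ + a _ * _).
  exact: val_inj.
pose c (i : 'I_2) := if i == ord0 then 0 else - mu.
apply: (@bidiag_code F L s 2 c) => //.
- move=> a x y a0 x0; rewrite !lin2E !ffunE /c /= mul0r mul0r add0r => ax.
  have a1 : a ord_max != 0.
    apply: contraNneq a0 => a1; apply/eqP/ffunP => i; rewrite ffunE.
    have a00 : a ord0 = 0.
      move/eqP: ax; rewrite a1 mul0r addr0 mulf_eq0 (negPf x0) orbF.
      by move/eqP.
    have [->|->] // : i = ord0 \/ i = ord_max.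
    by case: i => -[|[|//]] i; [left|right]; apply: val_inj.
  have := muP (y / x); apply: contraNneq => eq0.
  have xq : x ^+ #|F| != 0 by rewrite expf_neq0.
  apply/eqP; apply: (mulfI (mulf_neq0 a1 xq)).
  have a0E : a ord0 = - (a ord_max * x ^+ #|F|) / x.
    by apply: (canRL (mulfK x0)); apply/eqP; rewrite -addr_eq0 ax.
  apply/eqP; rewrite -subr_eq0; apply/eqP; rewrite -[RHS]eq0 a0E expr_div_n.
  move: (x ^+ _) (y ^+ _) xq => X Y X0.
  by field; rewrite x0 X0.
- by rewrite -(prednK s_gt0) mulSn; lia.
exists [ffun i => if i == ord0 then 1 else -1].
  by apply/eqP => /ffunP/(_ ord0)/eqP; rewrite !ffunE oner_eq0.
rewrite leqNgt subn1; apply/negP => rk.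
pose V : 'M[F]_(s, dim L) :=
  \matrix_(i < s) if i.+1 == s then v2r (1 : L) else 0.
have entV (i : 'I_s) : block_entry V i = if i.+1 == s then 1 else 0.
  by rewrite /block_entry rowK; case: eqP => _; rewrite ?v2rK ?linear0.
have VE : mxvec V *m bidiag_enc s c [ffun i => if i == ord0 then 1 else -1] = 0.
  rewrite mul_bidiag_mx; apply: (can_inj vec_mxK); rewrite mxvecK linear0.
  apply/row_matrixP => j; rewrite rowK row0 -[RHS](linear0 v2r); congr v2r.
  rewrite big1 => [|i /eqP ij]; last first.
    by rewrite entV ij ltn_eqF // linear0.
  rewrite entV addr0; case: eqP => _; last by rewrite linear0.
  by rewrite [LHS]lin2E !ffunE /= expr1n !mulr1 subrr.
have last_lt : (s.-1 < s)%N by rewrite prednK.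
have /eqP : block_entry V (Ordinal last_lt) = 1 by rewrite entV /= prednK ?eqxx.
suff -> : V = 0 by rewrite /block_entry row0 linear0 eq_sym oner_eq0.
apply: (can_inj mxvecK); rewrite linear0.
apply: (row_free_inj (A := bidiag_enc s c _));
  last by rewrite mul0mx; exact: VE.
by rewrite -row_leq_rank; lia.
Qed.

Local Close Scope ring_scope.

Theorem theorem5p9 (F : finFieldType) (m s d : nat)
    (hm : 2 <= m) (hs : 2 <= s)
    (hd : 1 <= d <= m + 1 \/ d = s * m - 1 \/ d = s * m) :
  exists C : {vspace 'M[F]_(s * m)},
    mfd_code (block_triangular s m) (nu_min (block_triangular s m) d) d C.
Proof.
have m_gt0 : 0 < m := ltnW hm.
have s_gt0 : 0 < s := ltnW hs.
have m2_le : 2 * m <= s * m by rewrite leq_mul2r hs orbT.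
have nu_min_large e : e < 2 ->
    nu_min (block_triangular s m) (s * m - e) = e.+1 * m.
  move=> e_lt2; have nu0 := nu0_block_triangular s_gt0 (leq_trans e_lt2 hm).
  rewrite nu_min_nu0 ?nu0 // => j; exact: nu_block_triangular_ge.
case: hd => [/andP[d_gt0 d_le]|[->|->]]; last 2 first.
- have [C codeC] := corank_one_code F s_gt0 hm.
  by exists C; split; rewrite nu_min_large.
- have [C codeC] := full_rank_code F s_gt0 m_gt0.
  have := nu_min_large 0 isT; rewrite subn0 mul1n => ->.
  by exists C; split=> //; rewrite -[X in nu_min _ X]subn0 nu_min_large ?mul1n.
have d_le_n : d <= s * m by lia.
have top (i j : 'I_(s * m)) : i.+1 < d -> (i, j) \in block_triangular s m.
  by move=> id; rewrite mem_block_triangular divn_small //=; lia.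
have d1_lt : d.-1 < s * m by rewrite prednK.
have last_lt : (s * m).-1 < s * m by rewrite prednK // (leq_trans d_gt0).
have [||C codeC] :=
  @etzion_silberstein F (s * m) (block_triangular s m) d _ top.
- by rewrite d_gt0.
- exists (Ordinal d1_lt, Ordinal last_lt); last by rewrite /= prednK.
  by rewrite mem_block_triangular; apply: leq_div2r => /=; lia.
have nu_minE : nu_min (block_triangular s m) d = nu (block_triangular s m) d 0.
  by apply: nu_min_nu0 => j jd; apply: nu0_le_nu.
by exists C; split=> //; rewrite nu_minE nu0_card ?d_gt0.
Qed.
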